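(* Let $V$ be a finite-dimensional real vector space with ordered bases $s=\{s_0,\dots,s_N\}$, $t=\{t_0,\dots,t_N\}$ and $v=\{v_0,\dots,v_N\}$. Suppose that the change of basis mapping from $s$ to $t$ has coefficient function $\alpha_1$ and the change of basis mapping from $v$ to $s$ has coefficient function $\alpha_2$, i.e. for all $0\le n\le N$, $$s_n=\sum_{k=0}^{n}\alpha_1(n,k)\,t_{n-k},\qquad v_n=\sum_{k=0}^{n}\alpha_2(n,k)\,s_{n-k},$$ with $\alpha_1(n,k),\alpha_2(n,k)\in\mathbb{R}$. Then the change of basis mapping from $v$ to $t$ has a coefficient function $\alpha_3$, i.e. $v_n=\sum_{k=0}^{n}\alpha_3(n,k)\,t_{n-k}$ for all $0\le n\le N$, and it is given by $$\alpha_3(n,k)=\sum_{j=0}^{k}\alpha_1(n-j,\,k-j)\,\alpha_2(n,j)\qquad(0\le k\le n\le N).$$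
   Context: For ordered bases $s$ and $t$ of $V$, a coefficient function of the change of basis mapping $s\to t$ is a function $\alpha$ with $s_n=\sum_{k=0}^{n}\alpha(n,k)\,t_{n-k}$ for every $n$; this says that the change of basis matrix whose columns are the coordinates of $s_0,\dots,s_N$ with respect to $t$ is upper triangular. *)

(* Defs.v *)
From mathcomp Require Import all_boot all_order all_algebra reals.
Set Implicit Arguments.
Unset Strict Implicit.
Unset Printing Implicit Defensive.
Import GRing.Theory.
Local Open Scope ring_scope.

(* Only the values [alpha n k] with k <= n <= N are constrained, so that
   [n - k] is a genuine subtraction and every index is within the bounds of
   the tuples. *)
Definition coefficient_function (R : realType) (V : vectType R) (N : nat)
    (s t : N.+1.-tuple V) (alpha : nat -> nat -> R) : Prop :=
  forall n : nat, (n <= N)%N ->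
    s`_n = \sum_(0 <= k < n.+1) alpha n k *: t`_(n - k)%N.

(* Main.v *)
Require Import Defs.
From mathcomp Require Import all_boot all_order all_algebra reals.
Set Implicit Arguments.
Unset Strict Implicit.
Unset Printing Implicit Defensive.
Import GRing.Theory.
Local Open Scope ring_scope.

(** Substituting [s] into the expansion of [v] and collecting the coefficient of
    [t`_(n - k)] gives the stated convolution; any coefficient function agrees
    with it on [k <= n <= N] by linear independence of [t]. *)

Lemma coefficient_function_comp (R : realType) (V : vectType R) (N : nat)
    (s t v : N.+1.-tuple V) (alpha1 alpha2 : nat -> nat -> R) :
  coefficient_function s t alpha1 -> coefficient_function v s alpha2 ->
  coefficient_function v t (fun n k =>
    \sum_(0 <= j < k.+1) alpha1 (n - j)%N (k - j)%N * alpha2 n j).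
Proof.
move=> st vs n nN; rewrite vs //.
(* The range of the inner sum depends on [k]; extending it to [j < n.+1] under the guard [j < k.+1]
   gives both sums fixed bounds, so that they can be exchanged. *)
under [RHS]eq_big_nat => k /andP[_ kn].
  rewrite scaler_suml (big_nat_widen _ _ n.+1) //; over.
rewrite (exchange_big_dep_nat predT) //=.
apply: eq_big_nat => j /andP[_]; rewrite ltnS => jn.
rewrite st ?(leq_trans (leq_subr _ _)) // scaler_sumr.
(* For fixed [j] the guard leaves [j <= k <= n]. The shift [k = i + j] turns this into [i <= n - j],
   the range in the expansion of the vector of [s] at index [n - j]. *)
under [RHS]eq_bigl do rewrite ltnS.
rewrite -(big_nat_widenl j 0%N n.+1 predT) //.
rewrite (big_addn 0 n.+1 j) subSn //.
by apply: eq_bigr => i _; rewrite addnK scalerA mulrC subnDA subnAC.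
Qed.

Lemma coefficient_function_unique (R : realType) (V : vectType R) (N : nat)
    (v t : N.+1.-tuple V) (alpha beta : nat -> nat -> R) :
  free t -> coefficient_function v t alpha -> coefficient_function v t beta ->
  forall n k : nat, (k <= n)%N -> (n <= N)%N -> alpha n k = beta n k.
Proof.
move=> /freeP free_t va vb n k kn nN.
(* Reversing the sum indexes it by the position [i = n - k] in [t]; it then runs over all of
   ['I_N.+1], cut off at [n], to fit the form of [freeP]. *)
have expand gamma : coefficient_function v t gamma ->
    v`_n = \sum_(i < N.+1 | (i < n.+1)%N) gamma n (n - i)%N *: t`_i.
  move=> /(_ n nN) ->; rewrite big_nat_rev add0n.
  rewrite -(big_ord_widen _ (fun i => gamma n (n - i)%N *: t`_i)) // big_mkord.
  by apply: eq_bigr => i _; rewrite subSS subKn // -ltnS.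
(* Differences of the two coefficients, padded by 0 beyond [n], where neither expansion has a
   term. *)
pose c (i : 'I_N.+1) :=
  if (i < n.+1)%N then alpha n (n - i)%N - beta n (n - i)%N else 0.
have c0 : \sum_(i < N.+1) c i *: t`_i = 0.
  transitivity (v`_n - v`_n); last exact: subrr.
  rewrite {1}(expand _ va) (expand _ vb) -sumrB [RHS]big_mkcond.
  by apply: eq_bigr => i _; rewrite /c; case: ifP; rewrite ?scale0r ?scalerBl.
(* Position [n - k] carries the coefficients at [k], since [n - (n - k) = k] for [k <= n]. *)
have nkN : (n - k < N.+1)%N by rewrite ltnS (leq_trans (leq_subr _ _)).
have := free_t c c0 (Ordinal nkN).
by rewrite /c /= ltnS leq_subr subKn // => /eqP; rewrite subr_eq0 => /eqP.
Qed.

Theorem mainTheorem2 (R : realType) (V : vectType R) (N : nat)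
    (s t v : N.+1.-tuple V)
    (s_basis : basis_of {:V} s) (t_basis : basis_of {:V} t)
    (v_basis : basis_of {:V} v)
    (alpha1 alpha2 : nat -> nat -> R)
    (alpha1P : coefficient_function s t alpha1)
    (alpha2P : coefficient_function v s alpha2) :
  (exists alpha3 : nat -> nat -> R, coefficient_function v t alpha3) /\
  (forall alpha3 : nat -> nat -> R, coefficient_function v t alpha3 ->
     forall n k : nat, (k <= n)%N -> (n <= N)%N ->
       alpha3 n k =
         \sum_(0 <= j < k.+1) alpha1 (n - j)%N (k - j)%N * alpha2 n j).
Proof.
have v_t := coefficient_function_comp alpha1P alpha2P.
split; first by exists (fun n k =>
  \sum_(0 <= j < k.+1) alpha1 (n - j)%N (k - j)%N * alpha2 n j).
move=> alpha3 alpha3P n k kn nN.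
exact: (coefficient_function_unique (basis_free t_basis) alpha3P v_t).
Qed.
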